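(* Let $\alpha\in(0,1/2)$. If the separation distances $\bar\kappa_{\text{in-in}}$ and $\bar\kappa_{\text{in-out}}$ corresponding to $(\theta^\#,\sigma^\#,\pi^* )$ satisfy $$\min\{\bar\kappa_{\text{in-in}},\bar\kappa_{\text{in-out}}\}\ \ge\ \sqrt{2d}+4\max\Big\{\big(2d\log(4nm/\alpha)\big)^{1/4},\ \big(3\log(8nm/\alpha)\big)^{1/2}\Big\},$$ then the LSL estimator $\hat\pi^{\mathrm{LSL}}_{n,m}$ detects the matching map $\pi^*$ with probability at least $1-\alpha$, that is, $$\mathbf P_{\theta^\#,\sigma^\#,\pi^*}\big(\hat\pi^{\mathrm{LSL}}_{n,m}=\pi^*\big)\ge 1-\alpha.$$
   Context: Notation: $[n]=\{1,\dots,n\}$; $\|\cdot\|$ is the Euclidean norm on $\mathbb R^d$. Model. Let $m>n\ge 2$ and $d\ge1$ be integers. The parameters are $\theta^\#=(\theta^\#_1,\dots,\theta^\#_m)$ with $\theta^\#_j\in\mathbb R^d$, $\sigma^\#=(\sigma^\#_1,\dots,\sigma^\#_m)$ with $\sigma_j^\#>0$, and an injective map $\pi^*:[n]\to[m]$. For $i\in[n]$ put $\theta_i=\theta^\#_{\pi^*(i)}$ and $\sigma_i=\sigma^\#_{\pi^*(i)}$. One observes $$X_i=\theta_i+\sigma_i\xi_i\ (i\in[n]),\qquad X^\#_j=\theta^\#_j+\sigma^\#_j\xi^\#_j\ (j\in[m]),$$ where $\xi_1,\dots,\xi_n,\xi^\#_1,\dots,\xi^\#_m$ are independent standard Gaussian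 vectors in $\mathbb R^d$ (zero mean, identity covariance). The law of $(X_1,\dots,X_n,X_1^\#,\dots,X_m^\#)$ is denoted $\mathbf P_{\theta^\#,\sigma^\#,\pi^*}$. The outlier index set is $O_{\pi^*}=[m]\setminus\mathrm{Im}(\pi^* )$. Separation distances: $$\bar\kappa_{\text{in-in}}=\min_{\substack{i,j\notin O_{\pi^*}\\ i\ne j}}\frac{\|\theta^\#_i-\theta^\#_j\|}{((\sigma^\#_i)^2+(\sigma^\#_j)^2)^{1/2}},\qquad \bar\kappa_{\text{in-out}}=\min_{\substack{i\notin O_{\pi^*}\\ j\in O_{\pi^*}}}\frac{\|\theta^\#_i-\theta^\#_j\|}{((\sigma^\#_i)^2+(\sigma^\#_j)^2)^{1/2}}.$$ LSL (least sum of logarithms) estimator: $$\hat\pi^{\mathrm{LSL}}_{n,m}\in\arg\min_{\pi:[n]\to[m]}\sum_{i=1}^n\log\|X_i-X^\#_{\pi(i)}\|^2,$$ the minimum being over all injective maps $\pi:[n]\to[m]$. *)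

(* Defs.v *)
From HB Require Import structures.
From mathcomp Require Import all_boot all_order all_algebra.
From mathcomp Require Import all_classical all_reals all_analysis.

Set Implicit Arguments.
Unset Strict Implicit.
Unset Printing Implicit Defensive.

Import Order.TTheory GRing.Theory Num.Theory.
Import numFieldNormedType.Exports.

Local Open Scope classical_set_scope.
Local Open Scope ring_scope.

(* R^d is represented by [d.-tuple R], whose measurable sets form the product
   (i.e. Borel) sigma-algebra. *)

(* The norm of the library on row vectors is the sup norm, hence this explicit
   Euclidean distance. *)
Definition eucl_dist (R : realType) (d : nat) (x y : d.-tuple R) : R :=
  Num.sqrt (\sum_(k < d) (tnth x k - tnth y k) ^+ 2).

Definition mutually_independent (disp disp' : measure_display)
    (T : measurableType disp) (E : measurableType disp') (R : realType)
    (P : probability T R) (I : finType) (Z : I -> T -> E) : Prop :=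
  forall (J : {set I}) (A : I -> set E), (forall i, measurable (A i)) ->
    P (\bigcap_(i in [set` J]) (Z i @^-1` A i)) =
    (\prod_(i in J) P (Z i @^-1` A i))%E.

(* N(0, I_d), given as the law of d independent N(0, 1) coordinates. *)
Definition standard_gaussian (disp : measure_display) (T : measurableType disp)
    (R : realType) (P : probability T R) (d : nat)
    (Z : T -> d.-tuple R) : Prop :=
  (forall (k : 'I_d) (A : set R), measurable A ->
     P ((fun w => tnth (Z w) k) @^-1` A) = normal_prob 0 1 A) /\
  mutually_independent P (fun (k : 'I_d) (w : T) => tnth (Z w) k).

(* The concatenation of the two families of noise vectors, used to express
   their joint independence. *)
Definition all_noise (disp : measure_display) (T : measurableType disp)
    (R : realType) (P : probability T R) (d n m : nat)
    (xi : 'I_n -> {RV P >-> d.-tuple R}) (xis : 'I_m -> {RV P >-> d.-tuple R})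
    (s : 'I_n + 'I_m) : T -> d.-tuple R :=
  match s with inl i => xi i | inr j => xis j end.

Definition affine_noise (R : realType) (d : nat) (t : d.-tuple R) (s : R)
    (z : d.-tuple R) : d.-tuple R :=
  [tuple tnth t k + s * tnth z k | k < d].

(* The space of the observations (X_1, .., X_n, X#_1, .., X#_m), a notation so
   that it inherits the product sigma-algebra. *)
Notation sample R d n m :=
  (n.-tuple (d.-tuple R) * m.-tuple (d.-tuple R))%type (only parsing).

Definition observation (disp : measure_display) (T : measurableType disp)
    (R : realType) (P : probability T R) (d n m : nat)
    (theta : 'I_m -> d.-tuple R) (sigma : 'I_m -> R)
    (pi : {ffun 'I_n -> 'I_m})
    (xi : 'I_n -> {RV P >-> d.-tuple R}) (xis : 'I_m -> {RV P >-> d.-tuple R})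
    (w : T) : sample R d n m :=
  ([tuple affine_noise (theta (pi i)) (sigma (pi i)) (xi i w) | i < n],
   [tuple affine_noise (theta j) (sigma j) (xis j w) | j < m]).

Definition outliers (n m : nat) (pi : {ffun 'I_n -> 'I_m}) : {set 'I_m} :=
  ~: [set pi i | i : 'I_n].

Definition sep_ratio (R : realType) (d m : nat)
    (theta : 'I_m -> d.-tuple R) (sigma : 'I_m -> R) (i j : 'I_m) : R :=
  eucl_dist (theta i) (theta j) / Num.sqrt (sigma i ^+ 2 + sigma j ^+ 2).

(* Minima over finite index sets are taken in \bar R, with +oo as the minimum
   over the empty set; for an injective pi and 2 <= n < m both index sets below
   are nonempty, so the two minima are attained real values. *)
Definition kappa_in_in (R : realType) (d n m : nat)
    (theta : 'I_m -> d.-tuple R) (sigma : 'I_m -> R)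
    (pi : {ffun 'I_n -> 'I_m}) : \bar R :=
  \big[Order.min/+oo%E]_(p : 'I_m * 'I_m |
      [&& p.1 \notin outliers pi, p.2 \notin outliers pi & p.1 != p.2])
    (sep_ratio theta sigma p.1 p.2)%:E.

Definition kappa_in_out (R : realType) (d n m : nat)
    (theta : 'I_m -> d.-tuple R) (sigma : 'I_m -> R)
    (pi : {ffun 'I_n -> 'I_m}) : \bar R :=
  \big[Order.min/+oo%E]_(p : 'I_m * 'I_m |
      (p.1 \notin outliers pi) && (p.2 \in outliers pi))
    (sep_ratio theta sigma p.1 p.2)%:E.

(* The logarithm is the extended one, with value -oo at 0, since [ln 0 = 0] in
   the library would distort the argmin when two observations coincide. *)
Definition LSL_loss (R : realType) (d n m : nat) (x : sample R d n m)
    (pi : {ffun 'I_n -> 'I_m}) : \bar R :=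
  (\sum_(i < n) lne ((eucl_dist (tnth x.1 i) (tnth x.2 (pi i)) ^+ 2)%:E))%E.

Definition is_LSL_argmin (R : realType) (d n m : nat) (x : sample R d n m)
    (pi : {ffun 'I_n -> 'I_m}) : Prop :=
  injective pi /\
  forall pi' : {ffun 'I_n -> 'I_m}, injective pi' ->
    (LSL_loss x pi <= LSL_loss x pi')%E.

(* A measurable selection of the (possibly non-unique) minimizer. *)
Definition LSL_estimator (R : realType) (d n m : nat)
    (pihat : sample R d n m -> {ffun 'I_n -> 'I_m}) : Prop :=
  (forall pi : {ffun 'I_n -> 'I_m}, measurable (pihat @^-1` [set pi])) /\
  (forall x : sample R d n m, is_LSL_argmin x (pihat x)).

Definition LSL_threshold (R : realType) (d n m : nat) (alpha : R) : R :=
  Num.sqrt (2 * d%:R) +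
  4 * Num.max ((2 * d%:R * ln (4 * n%:R * m%:R / alpha)) `^ (1 / 4))
              ((3 * ln (8 * n%:R * m%:R / alpha)) `^ (1 / 2)).

(* Main.v *)
Require Import Defs.
From HB Require Import structures.
From mathcomp Require Import all_boot all_order all_algebra.
From mathcomp Require Import all_classical all_reals all_analysis.
From mathcomp Require Import measurable_realfun.
From mathcomp Require Import ring lra.

Set Implicit Arguments.
Unset Strict Implicit.
Unset Printing Implicit Defensive.

Import Order.TTheory GRing.Theory Num.Theory.
Import numFieldNormedType.Exports.
Import HBNNSimple.

Local Open Scope classical_set_scope.
Local Open Scope ring_scope.

(** The separation is strong enough for a greedy argument: with probability at
    least 1 - alpha, every X_i is strictly closer to its match X#_(pi* i) than
    to any other X#_j. On that event pi* minimizes each summand of the loss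
    separately, so it is the only minimizer.

    Fix i and j <> pi* i, let Delta be the difference of the two means, V the
    difference of the two scaled noises, s^2 = sigma_i^2 + sigma_j^2 and
    K = ‖Delta‖ / s. Then
      ‖X_i - X#_j‖^2 = ‖Delta + V‖^2 >= ‖Delta‖^2 + 2 <Delta, V>,
    where <Delta, V> is a centred Gaussian of standard deviation s ‖Delta‖,
    whereas ‖X_i - X#_(pi* i)‖^2 = sigma_i^2 ‖xi_i - xi#_(pi* i)‖^2, which is
    2 sigma_i^2 times a chi-squared variable. Put
    r = sqrt (ln (8 n m / alpha)). Chernoff bounds give, each with probability
    at least 1 - exp (- r^2) = 1 - alpha / (8 n m),
      <Delta, V> > - sqrt 2 r s ‖Delta‖     (gaussian_linear_lower_tail),
      ‖xi_i - xi#_(pi* i)‖^2 < 2 (sqrt d + 2 r)^2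
                                            (gaussian_sqdist_upper_tail),
    so the comparison of distances follows from
      K^2 - 2 sqrt 2 r K > 2 (sqrt d + 2 r)^2,
    which is implied by K >= sqrt (2 d) + 4 sqrt 3 r (sqr_gt_of_separation),
    and the threshold is at least this large (LSL_threshold_ge). The union bound
    runs over at most 2 n m of these events.

    Since the loss takes the value -oo, a tie could still arise when X_i
    coincides with its match; this has probability 0 (gaussian_sqdist_neq0).

    The two Laplace transforms behind the Chernoff bounds come from one
    Gaussian integral (integral_normal_prob_expR_quad) and from the fact that
    expectations of products over independent coordinates factor
    (expectation_gaussian_pair). The latter is derived from independence of
    events by passing from indicators to nonnegative functions
    (ge0_integral_from_indic). *)

(** * Expectations of products of independent variables *)

(** Scaling a limit in the extended reals by +oo fails in general, through the
    product of +oo and 0; monotonicity excludes this. *)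
Lemma nondecreasing_cvgeMl (R : realType) (u : (\bar R)^nat) (c l : \bar R) :
  (0 <= c)%E -> (forall n, (0 <= u n)%E) -> nondecreasing_seq u ->
  u @ \oo --> l -> (fun n => c * u n)%E @ \oo --> (c * l)%E.
Proof.
move=> c0 u0 ndu ul.
have lE : l = ereal_sup (range u).
  apply: (cvg_unique _ ul) => //; exact: ereal_nondecreasing_cvgn.
have ule n : (u n <= l)%E by rewrite lE; apply: ereal_sup_ubound; exists n.
case: c c0 => [c _|_|//]; first exact: cvgeZl.
have [l0|l0] := eqVneq l 0%E.
  rewrite l0 mule0 (_ : (fun n => _) = cst 0%E); first exact: cvg_cst.
  apply/funext => n; rewrite (_ : u n = 0%E) ?mule0//.
  by apply/eqP; rewrite eq_le u0 -[X in (_ <= X)%E]l0 ule.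
have l_gt0 : (0 < l)%E by rewrite lt0e l0 (le_trans (u0 0%N)).
rewrite gt0_mulye//; apply: cvg_near_cst.
have : \forall n \near \oo, (0 < u n)%E.
  by apply: (ul [set y | (0 < y)%E]); exact: open_ereal_gt'.
by apply: filterS => n un; rewrite gt0_mulye.
Qed.

(** Two nonnegative densities, seen through a measurable map, that integrate
    indicators alike integrate all nonnegative functions alike: this is the
    step from sets to functions in every change of measure below. *)
Lemma ge0_integral_from_indic (R : realType) (d1 d2 : measure_display)
    (T : measurableType d1) (E : measurableType d2)
    (mu : {measure set T -> \bar R}) (nu : {measure set E -> \bar R})
    (Z : T -> E) (G : T -> \bar R) (h f : E -> \bar R) :
  measurable_fun setT Z ->
  measurable_fun setT G -> (forall x, 0 <= G x)%E ->
  measurable_fun setT h -> (forall x, 0 <= h x)%E ->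
  (forall B, measurable B -> (\int[mu]_x (G x * (\1_B (Z x))%:E) =
                              \int[nu]_y (h y * (\1_B y)%:E))%E) ->
  measurable_fun setT f -> (forall x, 0 <= f x)%E ->
  (\int[mu]_x (G x * f (Z x)) = \int[nu]_y (h y * f y))%E.
Proof.
move=> mZ mG G0 mh h0 indicE mf f0.
pose f_ := nnsfun_approx measurableT mf.
have f_cvg x : (fun n => (f_ n x)%:E) @ \oo --> f x by exact: cvg_nnsfun_approx.
have f_nd x : nondecreasing_seq (fun n => (f_ n x)%:E).
  by move=> a b ab; rewrite lee_fin; exact/lefP/nd_nnsfun_approx.
have approx (d3 : measure_display) (U : measurableType d3)
    (m : {measure set U -> \bar R}) (Y : U -> E) (g : U -> \bar R) :
    measurable_fun setT Y -> measurable_fun setT g -> (forall x, 0 <= g x)%E ->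
    (\int[m]_x (g x * f (Y x)) =
     limn (fun n => \int[m]_x (g x * (f_ n (Y x))%:E)))%E.
  move=> mY mg g0.
  have gf x : (g x * f (Y x) = limn (fun n => g x * (f_ n (Y x))%:E))%E.
    apply/esym/cvg_lim => //.
    apply: (@nondecreasing_cvgeMl _ (fun n => (f_ n (Y x))%:E)) => // n.
    by rewrite /= lee_fin.
  under eq_integral do rewrite gf.
  apply: (@monotone_convergence _ U R m setT measurableT
    (fun n x => (g x * (f_ n (Y x))%:E)%E)) => //.
  - move=> n; apply: emeasurable_funM => //; apply/measurable_EFinP.
    exact: measurableT_comp.
  - by move=> n x _; rewrite mule_ge0 ?lee_fin.
  - by move=> x _ a b ab; rewrite lee_wpmul2l//; exact: f_nd.
have mid : measurable_fun [set: E] idfun by exact: measurable_id.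
rewrite approx// (approx _ _ nu idfun)//=.
suff step n : (\int[mu]_x (G x * (f_ n (Z x))%:E) =
               \int[nu]_y (h y * (f_ n y)%:E))%E.
  by congr (limn _); apply/funext => n; exact: step.
have simple (d3 : measure_display) (U : measurableType d3)
    (m : {measure set U -> \bar R}) (Y : U -> E) (g : U -> \bar R) :
    measurable_fun setT Y -> measurable_fun setT g -> (forall x, 0 <= g x)%E ->
    (\int[m]_x (g x * (f_ n (Y x))%:E) = \sum_(r \in range (f_ n))
     (r%:E * \int[m]_x (g x * (\1_(f_ n @^-1` [set r]) (Y x))%:E)))%E.
  move=> mY mg g0.
  have m1 r : measurable_fun setT (fun x => \1_(f_ n @^-1` [set r]) (Y x) : R).
    by apply: measurableT_comp => //; exact: measurable_indic.
  transitivity (\int[m]_x \sum_(r \in range (f_ n))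
      (g x * (r * \1_(f_ n @^-1` [set r]) (Y x))%:E))%E.
    apply: eq_integral => x _; rewrite fimfunE -fsumEFin// ge0_mule_fsumr//.
    by move=> r; rewrite EFinM nnfun_muleindic_ge0.
  rewrite ge0_integral_fsum//; last 2 first.
  - move=> r; apply: emeasurable_funM => //; apply/measurable_EFinP.
    exact: measurable_funM.
  - by move=> r x _; rewrite mule_ge0// EFinM nnfun_muleindic_ge0.
  apply: eq_fsbigr => r /[!inE] -[y _ <-].
  under eq_integral do rewrite EFinM muleCA.
  rewrite ge0_integralZl ?lee_fin//.
  - by apply: emeasurable_funM => //; apply/measurable_EFinP.
  - by move=> x _; rewrite mule_ge0 ?lee_fin.
rewrite simple// (simple _ _ nu idfun)//=.
by apply: eq_fsbigr => r _; rewrite indicE.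
Qed.

Lemma emeasurable_prod (R : realType) (d : measure_display)
    (T : measurableType d) (I : Type) (s : seq I) (Q : pred I)
    (h : I -> T -> \bar R) :
  (forall i, measurable_fun setT (h i)) ->
  measurable_fun setT (fun x => \prod_(i <- s | Q i) h i x)%E.
Proof.
move=> mh; elim: s => [|i s IHs].
  by under eq_fun do rewrite big_nil; exact: measurable_cst.
under eq_fun do rewrite big_cons.
by case: (Q i) => //; exact: emeasurable_funM.
Qed.

(** Expectations of products factor: starting from indicators, where this is
    the definition of independence, the factors are replaced one at a time by
    arbitrary nonnegative functions. *)
Lemma expectation_prod_independent (R : realType) (d1 d2 : measure_display)
    (T : measurableType d1) (E : measurableType d2) (P : probability T R)
    (I : finType) (Z : I -> T -> E) (f : I -> E -> \bar R) :
  (forall i, measurable_fun setT (Z i)) -> mutually_independent P Z ->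
  (forall i, measurable_fun setT (f i)) -> (forall i x, 0 <= f i x)%E ->
  (\int[P]_w (\prod_i f i (Z i w)) = \prod_i \int[P]_w f i (Z i w))%E.
Proof.
move=> mZ indep.
suff ext (s : seq I) (g : I -> E -> \bar R) :
    (forall i, measurable_fun setT (g i)) -> (forall i x, 0 <= g i x)%E ->
    (forall i, i \notin s ->
       exists2 A, measurable A & g i = fun x => (\1_A x)%:E) ->
    (\int[P]_w (\prod_i g i (Z i w)) = \prod_i \int[P]_w g i (Z i w))%E.
  move=> mf f0; apply: (ext (enum I)) => // i.
  by rewrite mem_enum.
elim: s g => [|k s IHs] g mg g0 g_indic.
  have /choice[A gA] : forall i, exists A, measurable A /\
      g i = fun x => (\1_A x)%:E.
    by move=> i; have [//|A mA gE] := g_indic i; exists A.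
  have mZA i : measurable (Z i @^-1` A i).
    by rewrite -[X in measurable X]setTI; apply: mZ => //; case: (gA i).
  transitivity (P (\bigcap_(i in [set` [set: I]%SET]) (Z i @^-1` A i))).
    rewrite -[X in P X]setIT -integral_indic//; last exact: fin_bigcap_measurable.
    apply: eq_integral => w _; rewrite indicE.
    have [wA|wA] := boolP (w \in _).
      rewrite big1// => i _; rewrite (gA i).2 indicE mem_set//.
      by move: wA; rewrite inE => /(_ i); apply; rewrite /= inE.
    have [i wAi] : exists i, ~ A i (Z i w).
      apply/existsNP => wall; move: wA; rewrite notin_setE; apply => i _.
      exact: wall.
    by rewrite (bigD1 i)//= (gA i).2 indicE memNset// mul0e.
  rewrite indep => [|i]; last by case: (gA i).
  rewrite (eq_bigl xpredT); last by move=> i; rewrite inE.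
  apply: eq_bigr => i _; rewrite -[X in P X]setIT -integral_indic//.
  by apply: eq_integral => w _; rewrite (gA i).2.
pose G w := (\prod_(i | i != k) g i (Z i w))%E.
pose c := (\prod_(i | i != k) \int[P]_w g i (Z i w))%E.
have mgZ i : measurable_fun setT (fun w => g i (Z i w)).
  exact: measurableT_comp.
have mG : measurable_fun setT G by exact: emeasurable_prod.
have c0 : (0 <= c)%E.
  by apply: prode_ge0 => i _; apply: integral_ge0.
under eq_integral do rewrite (bigD1 k)//= muleC.
rewrite (bigD1 k)//= [RHS]muleC.
have Zk_mfun := isMeasurableFun.Build _ _ _ _ (Z k) (mZ k).
pose Zk : {mfun T >-> E} := HB.pack (Z k) Zk_mfun.
rewrite (@ge0_integral_from_indic _ _ _ _ _ P (distribution P Zk) Zk G (cst c))//.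
- rewrite ge0_integralZl//; congr (_ * _)%E.
  by rewrite ge0_integral_distribution.
- by move=> w; apply: prode_ge0.
- move=> B mB; rewrite ge0_integralZl//=; last first.
    exact/measurable_EFinP/measurable_indic.
  rewrite ge0_integral_distribution//=; last first.
    exact/measurable_EFinP/measurable_indic.
  pose g' i := if i == k then fun x => (\1_B x)%:E else g i.
  have g'k : g' k = fun x => (\1_B x)%:E by rewrite /g' eqxx.
  have g'i i : i != k -> g' i = g i by rewrite /g' => /negbTE ->.
  have := IHs g'; rewrite (bigD1 k)//= g'k muleC => g'E.
  rewrite /c -(eq_bigr _ (fun i ik => congr1 (fun u => \int[P]_w u (Z i w))%E
    (g'i i ik))) -g'E.
  + apply: eq_integral => w _; rewrite (bigD1 k)//= g'k muleC; congr (_ * _)%E.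
    by apply: eq_bigr => i ik; rewrite g'i.
  + move=> i; rewrite /g'; case: ifP => // _.
    exact/measurable_EFinP/measurable_indic.
  + by move=> i x; rewrite /g'; case: ifP => // _; rewrite lee_fin.
  + move=> i nis; rewrite /g'; case: eqVneq => [_|ik]; first by exists B.
    by apply: g_indic; rewrite inE negb_or ik.
Qed.

(** Independence identifies the joint law of a pair with the product of the
    two laws, which makes iterated integration available. *)
Lemma expectation_independent_pair (R : realType) (d0 d1 d2 : measure_display)
    (T : measurableType d0) (E1 : measurableType d1) (E2 : measurableType d2)
    (P : probability T R) (X : {RV P >-> E1}) (Y : {RV P >-> E2})
    (F : E1 * E2 -> \bar R) :
  (forall A B, measurable A -> measurable B ->
     P (X @^-1` A `&` Y @^-1` B) = P (X @^-1` A) * P (Y @^-1` B))%E ->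
  measurable_fun setT F -> (forall z, 0 <= F z)%E ->
  (\int[P]_w F (X w, Y w) =
   \int[distribution P Y]_y \int[distribution P X]_x F (x, y))%E.
Proof.
move=> indep mF F0.
have mXY : measurable_fun setT (fun w => (X w, Y w)).
  by apply: measurable_fun_pair; exact: measurable_funP.
have XY_mfun := isMeasurableFun.Build _ _ _ _ _ mXY.
pose XY : {mfun T >-> (E1 * E2)%type} := HB.pack (fun w => (X w, Y w)) XY_mfun.
transitivity (\int[distribution P XY]_z F z)%E.
  by rewrite ge0_integral_distribution.
transitivity (\int[(distribution P X \x distribution P Y)]_z F z)%E.
  apply: eq_measure_integral => A mA _; apply/esym.
  by apply: product_measure_unique => // B C mB mC; exact: indep.
by rewrite fubini_tonelli2.
Qed.

(** * Gaussian integrals *)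

Lemma ge0_integral_normal_prob (R : realType) (m s : R) (f : R -> \bar R) :
  measurable_fun setT f -> (forall x, 0 <= f x)%E ->
  (\int[normal_prob m s]_x f x =
   \int[lebesgue_measure]_x ((normal_pdf m s x)%:E * f x))%E.
Proof.
move=> mf f0.
have mpdf : measurable_fun setT (fun x => (normal_pdf m s x)%:E).
  by apply/measurable_EFinP; exact: measurable_normal_pdf.
rewrite -(@ge0_integral_from_indic _ _ _ _ _ (normal_prob m s)
  lebesgue_measure idfun (cst 1%E))//=.
- by under [RHS]eq_integral do rewrite mul1e.
- exact: measurable_id.
- by move=> x; rewrite lee_fin normal_pdf_ge0.
- move=> B mB; under eq_integral do rewrite mul1e.
  rewrite integral_indic// setIT.
  rewrite -[LHS]/(\int[lebesgue_measure]_(x in B) (normal_pdf m s x)%:E)%E.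
  rewrite (integral_mkcond B).
  apply: eq_integral => x _; rewrite patchE indicE.
  by case: ifPn => _; rewrite ?mule1 ?mule0.
Qed.

(** Completing the square turns the integrand into a multiple of the density
    of a normal law of variance 1 / (1 - 2 a). *)
Lemma integral_normal_prob_expR_quad (R : realType) (a b : R) : a < 1 / 2 ->
  (\int[normal_prob 0 1]_x (expR (a * x ^+ 2 + b * x))%:E =
   ((Num.sqrt (1 - 2 * a))^-1 * expR (b ^+ 2 / (2 * (1 - 2 * a))))%:E)%E.
Proof.
move=> a_lt; have c_gt0 : 0 < 1 - 2 * a by lra.
set c := 1 - 2 * a in c_gt0 *.
have sc_gt0 : 0 < Num.sqrt c by rewrite sqrtr_gt0.
pose s := (Num.sqrt c)^-1.
have s_gt0 : 0 < s by rewrite invr_gt0.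
have s2 : s ^+ 2 = c^-1 by rewrite exprVn sqr_sqrtr// ltW.
have mexp : measurable_fun setT (fun x : R => (expR (a * x ^+ 2 + b * x))%:E).
  apply/measurable_EFinP; apply: measurableT_comp => //.
  by apply: measurable_funD; apply: measurable_funM.
rewrite ge0_integral_normal_prob//.
(* The coefficients of x^2 and x match for variance 1 / c and mean b / c; the
   constant left over is b^2 / (2 c). *)
have pdfE x : normal_pdf 0 1 x * expR (a * x ^+ 2 + b * x) =
    (s * expR (b ^+ 2 / (2 * c))) * normal_pdf (b / c) s x.
  rewrite !normal_pdfE ?oner_eq0 ?gt_eqF// /normal_peak /normal_fun.
  rewrite subr0 -[LHS]mulrA -expRD [RHS]mulrACA -expRD; congr (_ * expR _).
    rewrite expr1n mul1r -mulrnAr sqrtrM ?sqr_ge0// sqrtr_sqr gtr0_norm//.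
    by rewrite invfM mulVKf// gt_eqF.
  rewrite s2 expr1n -[in RHS]mulr_natr -[in LHS]mulr_natr /c; field.
  by rewrite gt_eqF.
under eq_integral do rewrite -EFinM pdfE EFinM.
rewrite ge0_integralZl ?lee_fin//; last 3 first.
- by apply/measurable_EFinP; exact: measurable_normal_pdf.
- by move=> x _; rewrite lee_fin normal_pdf_ge0.
- by rewrite mulr_ge0 ?expR_ge0// ltW.
by rewrite integral_normal_pdf mule1.
Qed.

Lemma measurable_tuple_coord (R : realType) (disp : measure_display)
    (T : measurableType disp) (P : probability T R) (d : nat)
    (X : {RV P >-> d.-tuple R}) (k : 'I_d) :
  measurable_fun setT (fun w => tnth (X w) k).
Proof. exact: (measurableT_comp (measurable_tnth k)). Qed.

Lemma expectation_gaussian_coord (R : realType) (disp : measure_display)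
    (T : measurableType disp) (P : probability T R) (d : nat)
    (X : {RV P >-> d.-tuple R}) (f : 'I_d -> R -> \bar R) :
  standard_gaussian P X ->
  (forall k, measurable_fun setT (f k)) -> (forall k x, 0 <= f k x)%E ->
  (\int[P]_w (\prod_k f k (tnth (X w) k)) =
   \prod_k \int[normal_prob 0 1]_x f k x)%E.
Proof.
move=> [law indep] mf f0.
rewrite (@expectation_prod_independent _ _ _ _ _ P _
  (fun k w => tnth (X w) k))//; last by move=> k; exact: measurable_tuple_coord.
apply: eq_bigr => k _.
(* The normal law lives on R with the sigma-algebra generated by the half-open
   intervals, a structure with the same measurable sets as that of R. *)
have mXk : measurable_fun setT
  ((fun w => tnth (X w) k) : T -> measurableTypeR R).
  exact: measurable_tuple_coord.
have Xk_mfun := isMeasurableFun.Build _ _ _ _ _ mXk.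
pose Xk : {mfun T >-> measurableTypeR R} :=
  HB.pack (fun w => tnth (X w) k) Xk_mfun.
transitivity (\int[distribution P Xk]_x f k x)%E; last first.
  by apply: eq_measure_integral => A mA _; exact: law.
by rewrite ge0_integral_distribution//; exact: mf.
Qed.

Definition independent_gaussians (R : realType) (disp : measure_display)
    (T : measurableType disp) (P : probability T R) (d : nat)
    (X Y : {RV P >-> d.-tuple R}) : Prop :=
  [/\ standard_gaussian P X, standard_gaussian P Y &
    forall A B, measurable A -> measurable B ->
      P (X @^-1` A `&` Y @^-1` B) = (P (X @^-1` A) * P (Y @^-1` B))%E].

(** For a pair of independent Gaussian vectors all the 2d coordinates are
    independent, so integrands that split over the coordinates reduce to
    double integrals against N(0, 1). *)
Lemma expectation_gaussian_pair (R : realType) (disp : measure_display)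
    (T : measurableType disp) (P : probability T R) (d : nat)
    (X Y : {RV P >-> d.-tuple R}) (g : 'I_d -> R * R -> \bar R) :
  independent_gaussians X Y ->
  (forall k, measurable_fun setT (g k)) -> (forall k z, 0 <= g k z)%E ->
  (\int[P]_w (\prod_k g k (tnth (X w) k, tnth (Y w) k)) =
   \prod_k \int[normal_prob 0 1]_v \int[normal_prob 0 1]_u g k (u, v))%E.
Proof.
move=> [gX gY indep] mg g0.
pose F (z : d.-tuple R * d.-tuple R) :=
  (\prod_k g k (tnth z.1 k, tnth z.2 k))%E.
have mF : measurable_fun setT F.
  apply: emeasurable_prod => k.
  apply: (measurableT_comp (mg k)); apply: measurable_fun_pair => /=.
    by apply: (measurableT_comp (measurable_tnth k)); exact: measurable_fst.
  by apply: (measurableT_comp (measurable_tnth k)); exact: measurable_snd.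
have F0 z : (0 <= F z)%E by apply: prode_ge0.
rewrite (expectation_independent_pair indep mF F0).
have inner y : (\int[distribution P X]_x F (x, y) =
    \prod_k \int[normal_prob 0 1]_u g k (u, tnth y k))%E.
  rewrite ge0_integral_distribution//; last exact: measurableT_comp.
  rewrite -(expectation_gaussian_coord (f := fun k u => g k (u, tnth y k)) gX)//.
  by move=> k; exact: measurableT_comp.
under eq_integral do rewrite inner.
have mG k : measurable_fun setT
    (fun v => \int[normal_prob 0 1]_u g k (u, v))%E.
  exact: (@measurable_fun_fubini_tonelli_G _ _ (measurableTypeR R) R R
    (normal_prob 0 1) (g k) (mg k) (g0 k)).
have G0 k v : (0 <= \int[normal_prob 0 1]_u g k (u, v))%E.
  exact: integral_ge0.
rewrite ge0_integral_distribution//.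
- exact: (expectation_gaussian_coord
    (f := fun k v => \int[normal_prob 0 1]_u g k (u, v))%E gY).
- apply: emeasurable_prod => k; apply: (measurableT_comp (mG k)).
  exact: measurable_tnth.
- by move=> y; apply: prode_ge0.
Qed.

Lemma expR_sumE (R : realType) (I : finType) (f : I -> R) :
  ((expR (\sum_i f i))%:E = \prod_i (expR (f i))%:E)%E.
Proof. by rewrite expR_sum prodEFin. Qed.

Lemma expectation_expR_gaussian_pair (R : realType) (disp : measure_display)
    (T : measurableType disp) (P : probability T R) (d : nat)
    (X Y : {RV P >-> d.-tuple R}) (q : 'I_d -> R * R -> R) :
  independent_gaussians X Y -> (forall k, measurable_fun setT (q k)) ->
  (\int[P]_w (expR (\sum_k q k (tnth (X w) k, tnth (Y w) k)))%:E =
   \prod_k \int[normal_prob 0 1]_v \int[normal_prob 0 1]_u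
     (expR (q k (u, v)))%:E)%E.
Proof.
move=> gXY mq; under eq_integral do rewrite expR_sumE.
apply: (expectation_gaussian_pair (g := fun k z => (expR (q k z))%:E) gXY).
- by move=> k; apply/measurable_EFinP; exact: measurableT_comp.
- by move=> k z; rewrite lee_fin expR_ge0.
Qed.

Lemma expectation_expR_gaussian_linear (R : realType) (disp : measure_display)
    (T : measurableType disp) (P : probability T R) (d : nat)
    (X Y : {RV P >-> d.-tuple R}) (b c : 'I_d -> R) :
  independent_gaussians X Y ->
  (\int[P]_w (expR (\sum_k (b k * tnth (X w) k + c k * tnth (Y w) k)))%:E =
   (expR (\sum_k (b k ^+ 2 + c k ^+ 2) / 2))%:E)%E.
Proof.
move=> gXY.
rewrite (expectation_expR_gaussian_pair
  (q := fun k z => b k * z.1 + c k * z.2) gXY); last first.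
  by move=> k; apply: measurable_funD; apply: measurable_funM.
have lin (a : R) : (\int[normal_prob 0 1]_u (expR (a * u))%:E =
    (expR (a ^+ 2 / 2))%:E)%E.
  have := @integral_normal_prob_expR_quad R 0 a.
  rewrite mulr0 subr0 mulr1 sqrtr1 invr1 !mul1r => <-; last by lra.
  by apply: eq_integral => u _; rewrite mul0r add0r.
have mlin (a : R) : measurable_fun setT (fun u : R => (expR (a * u))%:E).
  by apply/measurable_EFinP/measurableT_comp => //; apply: measurable_funM.
rewrite expR_sumE; apply: eq_bigr => k _ /=.
transitivity (\int[normal_prob 0 1]_v
    ((expR (b k ^+ 2 / 2))%:E * (expR (c k * v))%:E))%E.
  apply: eq_integral => v _; rewrite -lin -ge0_integralZr//; last exact: mlin.
  by apply: eq_integral => u _; rewrite expRD EFinM.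
rewrite ge0_integralZl//; last exact: mlin.
by rewrite lin -EFinM -expRD mulrDl.
Qed.

(** ‖X - Y‖^2 / 2 has the chi-squared law with d degrees of freedom; this is its
    Laplace transform at 2 l. *)
Lemma expectation_expR_gaussian_sqdist (R : realType) (disp : measure_display)
    (T : measurableType disp) (P : probability T R) (d : nat)
    (X Y : {RV P >-> d.-tuple R}) (l : R) :
  independent_gaussians X Y -> l < 1 / 4 ->
  (\int[P]_w (expR (l * \sum_k (tnth (X w) k - tnth (Y w) k) ^+ 2))%:E =
   (((Num.sqrt (1 - 4 * l))^-1) ^+ d)%:E)%E.
Proof.
move=> gXY l_lt; under eq_integral do rewrite mulr_sumr.
rewrite (expectation_expR_gaussian_pair
  (q := fun k z => l * (z.1 - z.2) ^+ 2) gXY); last first.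
  move=> k; apply: measurable_funM => //; apply: measurable_funX.
  by apply: measurable_funB; [exact: measurable_fst|exact: measurable_snd].
have c_gt0 : 0 < 1 - 2 * l by lra.
(* Integrating out a coordinate of X leaves a multiple of exp (a v^2), with v the
   coordinate of Y. *)
pose a := l / (1 - 2 * l).
have a_lt : a < 1 / 2 by rewrite /a ltr_pdivrMr//; lra.
rewrite /= (eq_bigr (fun=> ((Num.sqrt (1 - 4 * l))^-1)%:E)); last first.
  move=> k _.
  transitivity (\int[normal_prob 0 1]_v
     (((Num.sqrt (1 - 2 * l))^-1)%:E * (expR (a * v ^+ 2 + 0 * v))%:E))%E.
    apply: eq_integral => v _.
    transitivity (\int[normal_prob 0 1]_u ((expR (l * v ^+ 2))%:E *
        (expR (l * u ^+ 2 + (- (2 * l * v)) * u))%:E))%E.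
      apply: eq_integral => u _; rewrite -EFinM -expRD; congr (expR _)%:E.
      ring.
    rewrite ge0_integralZl ?lee_fin ?expR_ge0//; last first.
      apply/measurable_EFinP/measurableT_comp => //.
      by apply: measurable_funD; apply: measurable_funM.
    rewrite integral_normal_prob_expR_quad; last by lra.
    rewrite -!EFinM mulrCA -expRD; congr (_ * expR _)%:E.
    by rewrite /a; field; rewrite gt_eqF.
  rewrite ge0_integralZl ?lee_fin ?invr_ge0//; last first.
    apply/measurable_EFinP/measurableT_comp => //.
    by apply: measurable_funD; apply: measurable_funM.
  rewrite integral_normal_prob_expR_quad// expr0n mul0r expR0 mulr1 -EFinM.
  rewrite -invfM -sqrtrM ?ltW//; congr (_^-1)%:E; congr Num.sqrt.
  by rewrite /a; field; rewrite gt_eqF.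
by rewrite prodEFin prodr_const card_ord.
Qed.

(** * Gaussian tail bounds *)

Lemma measurable_sublevel (R : realType) (disp : measure_display)
    (T : measurableType disp) (Y : T -> R) (a : R) :
  measurable_fun setT Y -> measurable [set w | Y w <= a].
Proof.
move=> mY; rewrite -[X in measurable X]setTI.
rewrite -[X in _ `&` X]/(Y @^-1` [set x | x <= a]) -set_itvNyc.
exact: mY.
Qed.

Lemma measurable_superlevel (R : realType) (disp : measure_display)
    (T : measurableType disp) (Y : T -> R) (a : R) :
  measurable_fun setT Y -> measurable [set w | a <= Y w].
Proof.
move=> mY; rewrite -[X in measurable X]setTI.
rewrite -[X in _ `&` X]/(Y @^-1` [set x | a <= x]) -set_itvcy.
exact: mY.
Qed.

Lemma chernoff_expR (R : realType) (disp : measure_display)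
    (T : measurableType disp) (P : probability T R) (Y : T -> R) :
  measurable_fun setT Y ->
  (P [set w | (0 <= Y w)%R] <= \int[P]_w (expR (Y w))%:E)%E.
Proof.
move=> mY.
have mA : measurable [set w | 0 <= Y w] by exact: measurable_superlevel.
rewrite -[X in P X]setIT -integral_indic//; apply: ge0_le_integral => //.
- exact/measurable_EFinP/measurable_indic.
- exact/measurable_EFinP/measurableT_comp.
- move=> w _; rewrite lee_fin indicE.
  have [|_] := boolP (w \in _); last exact: expR_ge0.
  by rewrite inE /= => Yw; rewrite -expR0 ler_expR.
Qed.

Definition sqdist (R : realType) (d : nat) (x y : d.-tuple R) : R :=
  \sum_k (tnth x k - tnth y k) ^+ 2.

Lemma sqdist_ge0 (R : realType) (d : nat) (x y : d.-tuple R) : 0 <= sqdist x y.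
Proof. by apply: sumr_ge0 => k _; exact: sqr_ge0. Qed.

Lemma measurable_sqdist (R : realType) (disp : measure_display)
    (T : measurableType disp) (P : probability T R) (d : nat)
    (X Y : {RV P >-> d.-tuple R}) :
  measurable_fun setT (fun w => sqdist (X w) (Y w)).
Proof.
apply: measurable_sum => k; apply: measurable_funX.
by apply: measurable_funB; exact: measurable_tuple_coord.
Qed.

(** The Chernoff bound at the parameter r / (4 (sqrt d + 2 r)), with the
    logarithm of the Laplace transform bounded through 1 + x <= exp x. *)
Lemma gaussian_sqdist_upper_tail (R : realType) (disp : measure_display)
    (T : measurableType disp) (P : probability T R) (d : nat)
    (X Y : {RV P >-> d.-tuple R}) (r : R) :
  independent_gaussians X Y -> 0 < r ->
  (P [set w | (2 * (Num.sqrt d%:R + 2 * r) ^+ 2 <= sqdist (X w) (Y w))%R]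
   <= (expR (- r ^+ 2))%:E)%E.
Proof.
move=> gXY r_gt0.
set D := Num.sqrt d%:R.
have D_ge0 : 0 <= D by exact: sqrtr_ge0.
have D2 : D ^+ 2 = d%:R by rewrite sqr_sqrtr.
have D2r : 0 < D + 2 * r by lra.
have Dr : 0 < D + r by lra.
pose l := r / (4 * (D + 2 * r)).
have l_gt0 : 0 < l by rewrite divr_gt0// mulr_gt0.
have l_lt : l < 1 / 4 by rewrite /l ltr_pdivrMr; lra.
pose b := 2 * (D + 2 * r) ^+ 2.
rewrite (_ : [set w | _] = [set w | 0 <= l * sqdist (X w) (Y w) - l * b]);
  last first.
  by apply/seteqP; split=> w /=; rewrite subr_ge0 ler_pM2l.
apply: (le_trans (chernoff_expR _ _)).
  by apply: measurable_funB => //; apply: measurable_funM => //;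
    exact: measurable_sqdist.
rewrite (_ : (\int[P]_w _)%E = (expR (- (l * b)) *
    ((Num.sqrt (1 - 4 * l))^-1) ^+ d)%:E); last first.
  rewrite EFinM -(expectation_expR_gaussian_sqdist gXY l_lt).
  rewrite -ge0_integralZl//; last first.
    apply/measurable_EFinP/measurableT_comp => //.
    by apply: measurable_funM => //; exact: measurable_sqdist.
  by apply: eq_integral => w _; rewrite -EFinM -expRD addrC.
(* 1 / (1 - 4 l) = 1 + r / (D + r) <= exp (r / (D + r)), and a square root halves
   the exponent. *)
have c_inv : (1 - 4 * l)^-1 = 1 + r / (D + r).
  by rewrite /l; field; rewrite !gt_eqF//; lra.
have sqrt_le : (Num.sqrt (1 - 4 * l))^-1 <= expR (r / (2 * (D + r))).
  rewrite -sqrtrV; last by lra.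
  rewrite -[leRHS]ger0_norm ?expR_ge0// -sqrtr_sqr ler_wsqrtr// c_inv.
  apply: (le_trans (expR_ge1Dx _)); rewrite -expRM_natl ler_expR.
  by rewrite le_eqVlt; apply/orP; left; apply/eqP; field; rewrite gt_eqF.
rewrite lee_fin; apply: (@le_trans _ _
    (expR (- (l * b)) * expR (r / (2 * (D + r))) ^+ d)).
  rewrite ler_wpM2l ?expR_ge0//.
  by apply: lerXn2r; rewrite ?nnegrE ?expR_ge0// invr_ge0 sqrtr_ge0.
rewrite -expRM_natl -expRD ler_expR -D2 /l /b.
rewrite (_ : _ + _ = - (r ^+ 2 * ((3 * D + 2 * r) / (2 * (D + r))))).
  rewrite lerN2 ler_peMr ?sqr_ge0// ler_pdivlMr; lra.
by field; rewrite !gt_eqF.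
Qed.

(** The Laplace transform at arbitrarily negative parameters shows that the two
    vectors almost surely differ. *)
Lemma gaussian_sqdist_neq0 (R : realType) (disp : measure_display)
    (T : measurableType disp) (P : probability T R) (d : nat)
    (X Y : {RV P >-> d.-tuple R}) :
  (0 < d)%N -> independent_gaussians X Y ->
  P [set w | (sqdist (X w) (Y w) <= 0)%R] = 0%E.
Proof.
move=> d_gt0 gXY; apply/eqP; rewrite eq_le measure_ge0 andbT.
apply/lee_addgt0Pr => e e_gt0; rewrite add0e.
have [e_le1|e_gt1] := leP e 1; last first.
  apply: (@le_trans _ _ 1%E); last by rewrite lee_fin ltW.
  by apply/probability_le1/measurable_sublevel; exact: measurable_sqdist.
(* With this parameter the Laplace transform is e^d. *)
pose l : R := (1 - e ^- 2) / 4.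
have e2_ge1 : 1 <= e ^- 2 by rewrite -exprVn expr_ge1 ?invr_ge0 ?invf_ge1// ltW.
have l_le0 : l <= 0 by rewrite /l; lra.
apply: (@le_trans _ _ (P [set w | 0 <= l * sqdist (X w) (Y w)])).
  apply: le_measure; rewrite ?inE.
  - by apply: measurable_sublevel; exact: measurable_sqdist.
  - apply: measurable_superlevel; apply: measurable_funM => //.
    exact: measurable_sqdist.
  - by move=> w /= sq_le0; rewrite mulr_le0.
apply: (le_trans (chernoff_expR _ _)).
  by apply: measurable_funM => //; exact: measurable_sqdist.
rewrite expectation_expR_gaussian_sqdist//; last by lra.
rewrite (_ : 1 - 4 * l = e ^- 2); last by rewrite /l; lra.
rewrite -exprVn sqrtr_sqr gtr0_norm ?invr_gt0// invrK lee_fin.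
by rewrite -[leRHS]expr1 ler_wiXn2l// ltW.
Qed.

(** The linear form is centred Gaussian with variance v^2, and the parameter
    sqrt 2 r / v optimizes the Chernoff bound. *)
Lemma gaussian_linear_lower_tail (R : realType) (disp : measure_display)
    (T : measurableType disp) (P : probability T R) (d : nat)
    (X Y : {RV P >-> d.-tuple R}) (b c : 'I_d -> R) (v r : R) :
  independent_gaussians X Y ->
  \sum_k (b k ^+ 2 + c k ^+ 2) = v ^+ 2 -> 0 < v -> 0 < r ->
  (P [set w | (\sum_k (b k * tnth (X w) k + c k * tnth (Y w) k) <=
               - (v * (Num.sqrt 2 * r)))%R]
   <= (expR (- r ^+ 2))%:E)%E.
Proof.
move=> gXY vE v_gt0 r_gt0.
pose l := Num.sqrt 2 * r / v.
have s2 : Num.sqrt 2 ^+ 2 = 2 :> R by rewrite sqr_sqrtr.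
have s2_gt0 : 0 < Num.sqrt 2 :> R by rewrite sqrtr_gt0.
have l_gt0 : 0 < l by rewrite divr_gt0// mulr_gt0.
rewrite (_ : [set w | _] = [set w | 0 <= \sum_k ((- l * b k) * tnth (X w) k +
    (- l * c k) * tnth (Y w) k) - l * (v * (Num.sqrt 2 * r))]); last first.
  have linE w : \sum_k ((- l * b k) * tnth (X w) k + (- l * c k) * tnth (Y w) k)
      = - l * \sum_k (b k * tnth (X w) k + c k * tnth (Y w) k).
    by rewrite mulr_sumr; apply: eq_bigr => k _; ring.
  by apply/seteqP; split=> w /=; rewrite linE mulNr -opprD oppr_ge0 -mulrDr
    pmulr_rle0// -lerBrDr add0r.
apply: (le_trans (chernoff_expR _ _)).
  apply: measurable_funB => //; apply: measurable_sum => k.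
  by apply: measurable_funD; apply: measurable_funM => //;
    exact: measurable_tuple_coord.
rewrite (_ : (\int[P]_w _)%E = (expR (- (l * (v * (Num.sqrt 2 * r)))) *
    expR (l ^+ 2 * v ^+ 2 / 2))%:E); last first.
  rewrite (_ : l ^+ 2 * v ^+ 2 =
      \sum_k ((- l * b k) ^+ 2 + (- l * c k) ^+ 2)); last first.
    rewrite -vE mulr_sumr; apply: eq_bigr => k _; ring.
  rewrite mulr_suml EFinM.
  rewrite -(expectation_expR_gaussian_linear (fun k => - l * b k)
    (fun k => - l * c k) gXY).
  rewrite -ge0_integralZl//; last first.
    apply/measurable_EFinP/measurableT_comp => //; apply: measurable_sum => k.
    by apply: measurable_funD; apply: measurable_funM => //;
      exact: measurable_tuple_coord.
  by apply: eq_integral => w _; rewrite -EFinM -expRD addrC.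
rewrite lee_fin -expRD ler_expR.
rewrite (_ : l * _ = Num.sqrt 2 ^+ 2 * r ^+ 2); last first.
  by rewrite /l; field; rewrite gt_eqF.
rewrite (_ : l ^+ 2 * _ = Num.sqrt 2 ^+ 2 * r ^+ 2); last first.
  by rewrite /l; field; rewrite gt_eqF.
by rewrite s2; lra.
Qed.

(** * Comparison of distances and uniqueness of the minimizer *)

Lemma eucl_distE (R : realType) (d : nat) (x y : d.-tuple R) :
  eucl_dist x y ^+ 2 = sqdist x y.
Proof. by rewrite sqr_sqrtr// sqdist_ge0. Qed.

(** When every X_i is strictly closer to its match than to all the other
    candidates, the true matching is optimal term by term, hence the unique
    minimizer. The distances to the matches have to be positive, because a
    single vanishing distance sends the loss of several matchings to -oo. *)
Lemma LSL_argmin_unique (R : realType) (d n m : nat) (x : sample R d n m)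
    (pistar pi : {ffun 'I_n -> 'I_m}) :
  injective pistar ->
  (forall i, 0 < sqdist (tnth x.1 i) (tnth x.2 (pistar i))) ->
  (forall i j, j != pistar i -> sqdist (tnth x.1 i) (tnth x.2 (pistar i)) <
                                sqdist (tnth x.1 i) (tnth x.2 j)) ->
  is_LSL_argmin x pi -> pi = pistar.
Proof.
move=> pistar_inj pos closest [_ pi_min]; apply/eqP; apply/negPn/negP => pi_neq.
have pos' i j : 0 < sqdist (tnth x.1 i) (tnth x.2 j).
  by have [->//|/closest] := eqVneq j (pistar i); exact: lt_trans.
have lossE (p : {ffun 'I_n -> 'I_m}) : LSL_loss x p =
    (\sum_i ln (sqdist (tnth x.1 i) (tnth x.2 (p i))))%:E.
  rewrite /LSL_loss -sumEFin; apply: eq_bigr => i _.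
  by rewrite eucl_distE lne_EFin.
have [i pi_i] : exists i, pi i != pistar i.
  apply/existsP; rewrite -negb_forall; apply: contra pi_neq => /forallP pi_eq.
  by apply/eqP/ffunP => i; apply/eqP.
have := pi_min _ pistar_inj; rewrite !lossE lee_fin leNgt => /negP; apply.
rewrite (bigD1 i)//= [ltRHS](bigD1 i)//=; apply: ltr_leD.
  by rewrite ltr_ln ?posrE//; exact: closest.
apply: ler_sum => k _; have [->//|pi_k] := eqVneq (pi k) (pistar k).
by rewrite ler_ln ?posrE// ltW//; exact: closest.
Qed.

(** Completing the square leaves (K - sqrt 2 r)^2 > 2 (D + 2 r)^2 + 2 r^2, and
    K - sqrt 2 r is at least sqrt 2 D + 5 r because 4 sqrt 3 - sqrt 2 >= 5. *)
Lemma sqr_gt_of_separation (R : rcfType) (D r K : R) :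
  0 <= D -> 0 < r -> Num.sqrt 2 * D + 4 * (Num.sqrt 3 * r) <= K ->
  2 * (D + 2 * r) ^+ 2 < K ^+ 2 - 2 * (K * (Num.sqrt 2 * r)).
Proof.
move=> D_ge0 r_gt0.
have q2 : Num.sqrt 2 ^+ 2 = 2 :> R by rewrite sqr_sqrtr.
have p2 : Num.sqrt 3 ^+ 2 = 3 :> R by rewrite sqr_sqrtr.
have q_ge0 : 0 <= Num.sqrt 2 :> R by exact: sqrtr_ge0.
have p_ge0 : 0 <= Num.sqrt 3 :> R by exact: sqrtr_ge0.
move: (Num.sqrt 2) (Num.sqrt 3) q2 p2 q_ge0 p_ge0 => q p q2 p2 q_ge0 p_ge0 K_ge.
have p_ge : 17 / 10 <= p by nra.
have q_le : q <= 3 / 2 by nra.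
have low : q * D + 5 * r <= K - q * r by nra.
have q_ge : 1 <= q by nra.
have sq : (q * D + 5 * r) ^+ 2 <= (K - q * r) ^+ 2.
  by apply: lerXn2r => //; rewrite nnegrE; nra.
have Dr : 0 <= D * r by nra.
rewrite (_ : K ^+ 2 - _ = (K - q * r) ^+ 2 - q ^+ 2 * r ^+ 2); last by ring.
apply: lt_le_trans (lerB sq (lexx _)).
rewrite q2 (_ : (q * D + 5 * r) ^+ 2 =
  q ^+ 2 * D ^+ 2 + 10 * (q * (D * r)) + 25 * r ^+ 2); last by ring.
rewrite q2; nra.
Qed.

Lemma LSL_threshold_ge (R : realType) (d n m : nat) (alpha r : R) :
  0 <= r -> r ^+ 2 = ln (8 * n%:R * m%:R / alpha) ->
  Num.sqrt 2 * Num.sqrt d%:R + 4 * (Num.sqrt 3 * r) <= LSL_threshold d n m alpha.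
Proof.
move=> r_ge0 r2; rewrite /LSL_threshold -r2 sqrtrM// lerD2l ler_pM2l//.
rewrite le_max; apply/orP; right.
by rewrite mul1r powR12_sqrt ?mulr_ge0 ?sqr_ge0// sqrtrM// sqrtr_sqr ger0_norm.
Qed.

(** ‖X_i - X#_j‖^2 is at least ‖Delta‖^2 + 2 <Delta, V>, where Delta is the
    difference of the means and V that of the noises. Keeping the cross term
    as one scalar Gaussian, and not bounding it by ‖Delta‖ ‖V‖, is what keeps
    the leading term of the separation at sqrt (2 d). *)
Lemma sqdist_match_lt (R : realType) (d : nat) (D r s1 s2 K : R)
    (t1 t2 x y1 y2 : d.-tuple R) :
  0 <= D -> 0 < r -> 0 < s1 -> 0 < s2 ->
  Num.sqrt 2 * D + 4 * (Num.sqrt 3 * r) <= K ->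
  eucl_dist t1 t2 = K * Num.sqrt (s1 ^+ 2 + s2 ^+ 2) ->
  - (eucl_dist t1 t2 * Num.sqrt (s1 ^+ 2 + s2 ^+ 2) * (Num.sqrt 2 * r)) <
    \sum_k ((tnth t1 k - tnth t2 k) * s1 * tnth x k +
            - ((tnth t1 k - tnth t2 k) * s2) * tnth y2 k) ->
  sqdist x y1 < 2 * (D + 2 * r) ^+ 2 ->
  sqdist (affine_noise t1 s1 x) (affine_noise t1 s1 y1) <
  sqdist (affine_noise t1 s1 x) (affine_noise t2 s2 y2).
Proof.
move=> D_ge0 r_gt0 s1_gt0 s2_gt0 K_ge dist_eq lin_gt sq_lt.
set s := Num.sqrt _ in dist_eq lin_gt.
set L := \sum_k _ in lin_gt.
have s_sq : s ^+ 2 = s1 ^+ 2 + s2 ^+ 2 by rewrite sqr_sqrtr// addr_ge0 ?sqr_ge0.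
have s_gt0 : 0 < s by rewrite sqrtr_gt0 addr_gt0// exprn_gt0.
have matchE : sqdist (affine_noise t1 s1 x) (affine_noise t1 s1 y1) =
    s1 ^+ 2 * sqdist x y1.
  by rewrite /sqdist mulr_sumr; apply: eq_bigr => k _; rewrite !tnth_mktuple; ring.
have cross : eucl_dist t1 t2 ^+ 2 + 2 * L <=
    sqdist (affine_noise t1 s1 x) (affine_noise t2 s2 y2).
  rewrite eucl_distE /L /sqdist mulr_sumr -big_split /=.
  apply: ler_sum => k _; rewrite !tnth_mktuple -subr_ge0.
  rewrite (_ : _ - _ = (s1 * tnth x k - s2 * tnth y2 k) ^+ 2); last by ring.
  exact: sqr_ge0.
apply: lt_le_trans cross; rewrite matchE.
have K_sep := sqr_gt_of_separation D_ge0 r_gt0 K_ge.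
apply: (@lt_trans _ _ (s ^+ 2 * (2 * (D + 2 * r) ^+ 2))).
  apply: (@lt_le_trans _ _ (s1 ^+ 2 * (2 * (D + 2 * r) ^+ 2))).
    by rewrite ltr_pM2l// exprn_gt0.
  by rewrite s_sq ler_wpM2r ?lerDl ?sqr_ge0// mulr_ge0 ?sqr_ge0.
apply: (@lt_trans _ _ (s ^+ 2 * (K ^+ 2 - 2 * (K * (Num.sqrt 2 * r))))).
  by rewrite ltr_pM2l// exprn_gt0.
rewrite dist_eq in lin_gt *.
rewrite (_ : s ^+ 2 * _ = (K * s) ^+ 2 +
  2 * - (K * s * s * (Num.sqrt 2 * r))); last by ring.
by rewrite ltrD2l ltr_pM2l.
Qed.

Lemma sep_ratio_ge (R : realType) (d n m : nat) (theta : 'I_m -> d.-tuple R)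
    (sigma : 'I_m -> R) (pistar : {ffun 'I_n -> 'I_m}) (x : R) i j :
  (x%:E <= Order.min (kappa_in_in theta sigma pistar)
                     (kappa_in_out theta sigma pistar))%E ->
  j != pistar i -> x <= sep_ratio theta sigma (pistar i) j.
Proof.
rewrite le_min => /andP[x_in x_out] j_neq.
have pi_in : pistar i \notin outliers pistar by rewrite inE negbK imset_f.
rewrite -lee_fin; have [j_out|j_in] := boolP (j \in outliers pistar).
  apply: (le_trans x_out).
  by apply: (@bigmin_le_cond _ _ _ _ (pistar i, j)); rewrite /= pi_in j_out.
apply: (le_trans x_in).
by apply: (@bigmin_le_cond _ _ _ _ (pistar i, j));
  rewrite /= pi_in j_in eq_sym j_neq.
Qed.

(** * Probability of the bad event *)

Lemma measure_bigsetU_le (R : realType) (disp : measure_display)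
    (T : measurableType disp) (mu : {measure set T -> \bar R}) (I : finType)
    (Q : pred I) (A : I -> set T) :
  (forall i, measurable (A i)) ->
  (mu (\big[setU/set0]_(i | Q i) A i) <= \sum_(i | Q i) mu (A i))%E.
Proof.
move=> mA.
suff : measurable (\big[setU/set0]_(i | Q i) A i) /\
  (mu (\big[setU/set0]_(i | Q i) A i) <= \sum_(i | Q i) mu (A i))%E by case.
apply: (big_ind2 (fun B x => measurable B /\ (mu B <= x)%E)) => //.
- by split; rewrite ?measure0.
- move=> B x C y [mB Bx] [mC Cy]; split; first exact: measurableU.
  by apply: (le_trans (measureU2 _ _ _)) => //; exact: leeD.
Qed.

Lemma independent_gaussians_of_noise (R : realType) (disp : measure_display)
    (T : measurableType disp) (P : probability T R) (d n m : nat)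
    (xi : 'I_n -> {RV P >-> d.-tuple R}) (xis : 'I_m -> {RV P >-> d.-tuple R})
    (i : 'I_n) (j : 'I_m) :
  (forall i, standard_gaussian P (xi i)) ->
  (forall j, standard_gaussian P (xis j)) ->
  mutually_independent P (all_noise xi xis) ->
  independent_gaussians (xi i) (xis j).
Proof.
move=> gxi gxis indep; split => // A B mA mB.
pose C (s : 'I_n + 'I_m) := if s is inl _ then A else B.
have := indep [set inl i; inr j]%SET C; rewrite big_setU1 ?inE//= big_set1 /=.
move=> <-; last by case.
congr (P _); apply/seteqP; split => w /=.
  by case=> wA wB [k|k] /=; rewrite !inE => /orP[]// /eqP[->].
by move=> h; split; [apply: (h (inl i))|apply: (h (inr j))];
  rewrite /= !inE eqxx ?orbT.
Qed.

Lemma measurable_observation (R : realType) (disp : measure_display)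
    (T : measurableType disp) (P : probability T R) (d n m : nat)
    (theta : 'I_m -> d.-tuple R) (sigma : 'I_m -> R)
    (pi : {ffun 'I_n -> 'I_m})
    (xi : 'I_n -> {RV P >-> d.-tuple R}) (xis : 'I_m -> {RV P >-> d.-tuple R}) :
  measurable_fun setT (observation theta sigma pi xi xis).
Proof.
have maff (t : d.-tuple R) (s : R) (X : {RV P >-> d.-tuple R}) :
    measurable_fun setT (fun w => affine_noise t s (X w)).
  apply/measurable_fun_tnthP => k.
  rewrite (_ : _ \o _ = fun w => tnth t k + s * tnth (X w) k); last first.
    by apply/funext => w /=; rewrite tnth_mktuple.
  apply: measurable_funD => //; apply: measurable_funM => //.
  exact: measurable_tuple_coord.
apply: measurable_fun_pair; apply/measurable_fun_tnthP => i.
  rewrite (_ : _ \o _ = fun w =>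
    affine_noise (theta (pi i)) (sigma (pi i)) (xi i w))//.
  by apply/funext => w /=; rewrite tnth_mktuple.
rewrite (_ : _ \o _ = fun w => affine_noise (theta i) (sigma i) (xis i w))//.
by apply/funext => w /=; rewrite tnth_mktuple.
Qed.

Theorem theorem2 (R : realType) (disp : measure_display)
    (T : measurableType disp) (P : probability T R)
    (d n m : nat) (d_ge1 : (1 <= d)%N) (n_ge2 : (2 <= n)%N) (n_lt_m : (n < m)%N)
    (theta : 'I_m -> d.-tuple R)
    (sigma : 'I_m -> R) (sigma_gt0 : forall j, 0 < sigma j)
    (pistar : {ffun 'I_n -> 'I_m}) (pistar_inj : injective pistar)
    (xi : 'I_n -> {RV P >-> d.-tuple R}) (xis : 'I_m -> {RV P >-> d.-tuple R})
    (xi_gauss : forall i, standard_gaussian P (xi i))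
    (xis_gauss : forall j, standard_gaussian P (xis j))
    (noise_indep : mutually_independent P (all_noise xi xis))
    (pihat : sample R d n m -> {ffun 'I_n -> 'I_m})
    (pihat_LSL : LSL_estimator pihat)
    (alpha : R) (alpha_gt0 : 0 < alpha) (alpha_lt : alpha < 1 / 2)
    (separated : ((LSL_threshold d n m alpha)%:E <=
       Order.min (kappa_in_in theta sigma pistar)
                 (kappa_in_out theta sigma pistar))%E) :
  ((1 - alpha)%:E <=
    P [set w | pihat (observation theta sigma pistar xi xis w) = pistar])%E.
Proof.
have [pihat_meas pihat_min] := pihat_LSL.
have n_ge1 : 1 <= n%:R :> R by rewrite ler1n (leq_trans _ n_ge2).
have m_ge1 : 1 <= m%:R :> R by rewrite ler1n (leq_ltn_trans _ n_lt_m).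
have nm_ge1 : 1 <= n%:R * m%:R :> R by rewrite -[leLHS]mulr1 ler_pM.
pose M : R := 8 * n%:R * m%:R / alpha.
have M_gt1 : 1 < M by rewrite /M ltr_pdivlMr// mul1r -mulrA; lra.
pose r := Num.sqrt (ln M).
have r_gt0 : 0 < r by rewrite sqrtr_gt0 ln_gt0.
have r2 : r ^+ 2 = ln M by rewrite sqr_sqrtr// ltW// ln_gt0.
have tailE : expR (- r ^+ 2) = alpha / (8 * n%:R * m%:R).
  by rewrite r2 expRN lnK ?posrE ?(lt_trans _ M_gt1)// invf_div.
set D := Num.sqrt d%:R : R.
have D_ge0 : 0 <= D by exact: sqrtr_ge0.
have gauss i j : independent_gaussians (xi i) (xis j).
  exact: independent_gaussians_of_noise.
pose delta i j k := tnth (theta (pistar i)) k - tnth (theta j) k.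
pose s i j := Num.sqrt (sigma (pistar i) ^+ 2 + sigma j ^+ 2).
pose dist i j := eucl_dist (theta (pistar i)) (theta j).
have s_gt0 i j : 0 < s i j by rewrite sqrtr_gt0 addr_gt0// exprn_gt0.
have sep i j : j != pistar i ->
    Num.sqrt 2 * D + 4 * (Num.sqrt 3 * r) <= dist i j / s i j.
  move=> j_neq; apply: le_trans (sep_ratio_ge separated j_neq).
  exact: LSL_threshold_ge (ltW r_gt0) r2.
have dist_gt0 i j : j != pistar i -> 0 < dist i j.
  move=> /sep /(lt_le_trans _) K_gt0.
  rewrite -(pmulr_lgt0 _ (_ : 0 < (s i j)^-1)) ?invr_gt0//; apply: K_gt0.
  by rewrite ltr_wpDl ?mulr_ge0 ?sqrtr_ge0// !mulr_gt0// sqrtr_gt0.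
pose lin i j w := \sum_k (delta i j k * sigma (pistar i) * tnth (xi i w) k +
                          - (delta i j k * sigma j) * tnth (xis j w) k).
pose B1 i j := [set w | lin i j w <= - (dist i j * s i j * (Num.sqrt 2 * r))].
pose sq i w := sqdist (xi i w) (xis (pistar i) w).
pose B2 i := [set w | 2 * (D + 2 * r) ^+ 2 <= sq i w].
pose B3 i := [set w | sq i w <= 0].
pose Bi i := \big[setU/set0]_(j | j != pistar i) B1 i j `|` (B2 i `|` B3 i).
pose B := \big[setU/set0]_i Bi i.
have mB1 i j : measurable (B1 i j).
  apply: measurable_sublevel; apply: measurable_sum => k.
  by apply: measurable_funD; apply: measurable_funM => //;
    exact: measurable_tuple_coord.
have mB2 i : measurable (B2 i).
  by apply: measurable_superlevel; exact: measurable_sqdist.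
have mB3 i : measurable (B3 i).
  by apply: measurable_sublevel; exact: measurable_sqdist.
have mB23 i : measurable (B2 i `|` B3 i) by exact: measurableU.
have mB1U i : measurable (\big[setU/set0]_(j | j != pistar i) B1 i j).
  by apply: bigsetU_measurable => j _.
have mBi i : measurable (Bi i) by exact: measurableU.
have mB : measurable B by apply: bigsetU_measurable => i _.
have PB1 i j : j != pistar i -> (P (B1 i j) <= (expR (- r ^+ 2))%:E)%E.
  move=> j_neq; apply: gaussian_linear_lower_tail => //.
    rewrite exprMn eucl_distE sqr_sqrtr ?addr_ge0 ?sqr_ge0// /sqdist mulr_suml.
    by apply: eq_bigr => k _; rewrite /delta; ring.
  by rewrite mulr_gt0// dist_gt0.
have PBi i : (P (Bi i) <= (2 * m%:R * expR (- r ^+ 2))%:E)%E.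
  apply: (le_trans (measureU2 _ _ _)) => //.
  apply: (@le_trans _ _ ((m%:R * expR (- r ^+ 2))%:E + (expR (- r ^+ 2))%:E)%E).
    apply: leeD.
      apply: (le_trans (measure_bigsetU_le _ _ _)) => //.
      apply: (@le_trans _ _ (\sum_(j < m) (expR (- r ^+ 2))%:E)%E).
        rewrite big_mkcond; apply: lee_sum => j _.
        by case: ifPn => [/PB1//|_]; rewrite lee_fin expR_ge0.
      by rewrite sumEFin sumr_const card_ord mulr_natl.
    apply: (le_trans (measureU2 _ _ _)) => //.
    rewrite -[leRHS]adde0; apply: leeD; first exact: gaussian_sqdist_upper_tail.
    have /eqP := gaussian_sqdist_neq0 d_ge1 (gauss i (pistar i)).
    by rewrite eq_le => /andP[].
  rewrite -EFinD lee_fin -[X in _ + X]mul1r -mulrDl ler_wpM2r ?expR_ge0//; lra.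
have PB : (P B <= alpha%:E)%E.
  apply: (le_trans (measure_bigsetU_le _ _ _)) => //.
  apply: (@le_trans _ _ (\sum_(i < n) (2 * m%:R * expR (- r ^+ 2))%:E)%E).
    by apply: lee_sum => i _; exact: PBi.
  rewrite sumEFin sumr_const card_ord -[_ *+ n]mulr_natl lee_fin tailE.
  have -> : n%:R * (2 * m%:R * (alpha / (8 * n%:R * m%:R))) = alpha / 4.
    by field; rewrite !gt_eqF//; lra.
  lra.
have mE : measurable
    [set w | pihat (observation theta sigma pistar xi xis w) = pistar].
  rewrite -[X in measurable X]setTI.
  exact: (measurable_observation theta sigma pistar xi xis measurableT
    (pihat_meas pistar)).
apply: (@le_trans _ _ (P (~` B))).
  by rewrite probability_setC// EFinB leeB.
apply: le_measure; rewrite ?inE//; first exact: measurableC.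
move=> w /= nB.
have nBi i : ~ Bi i w by move=> Biw; apply: nB; rewrite /B (bigD1 i)//=; left.
have nB1 i j : j != pistar i -> ~ B1 i j w.
  by move=> ij B1w; apply: (nBi i); left; rewrite (bigD1 j)//=; left.
have nB2 i : ~ B2 i w by move=> B2w; apply: (nBi i); right; left.
have nB3 i : ~ B3 i w by move=> B3w; apply: (nBi i); right; right.
apply: LSL_argmin_unique (pihat_min _) => // [i|i j ij].
  rewrite !tnth_mktuple.
  have sq_gt0 : 0 < sq i w by rewrite ltNge; apply/negP; exact: nB3.
  rewrite (_ : sqdist _ _ = sigma (pistar i) ^+ 2 * sq i w).
    by rewrite mulr_gt0// exprn_gt0.
  by rewrite /sq /sqdist mulr_sumr; apply: eq_bigr => k _;
    rewrite !tnth_mktuple; ring.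
rewrite !tnth_mktuple.
apply: (sqdist_match_lt D_ge0 r_gt0 _ _ (sep i j ij)) => //.
- by rewrite divfK// gt_eqF.
- by rewrite ltNge; apply/negP; exact: nB1.
- by rewrite ltNge; apply/negP; exact: nB2.
Qed.
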